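(* Let $(\widetilde{M},\widetilde{g},F)$ be an almost product-like Riemannian manifold and let $(M,g)$ be a tangential hypersurface of $\widetilde{M}$ with unit normal vector field $N$, and let $\varphi,\varphi^{\ast},\eta,\eta^{\ast}$ be the induced objects on $M$. Then for any $X,Y\in\Gamma(TM)$: $$g(\varphi X,Y)=g(X,\varphi^{\ast}Y),$$ $$g(\varphi X,\varphi^{\ast}Y)=g(X,Y)-\eta^{\ast}(X)\eta(Y).$$ Moreover, $(\varphi^{\ast})^{\ast}=\varphi$ holds.
   Context: An almost product-like Riemannian manifold $(\widetilde{M},\widetilde{g},F)$ is a Riemannian manifold $(\widetilde{M},\widetilde{g})$ with a $(1,1)$-tensor field $F$ satisfying $F^{2}=I$, together with another $(1,1)$-tensor field $F^{\ast}$ satisfying $\widetilde{g}(FX,Y)=\widetilde{g}(X,F^{\ast}Y)$ for all vector fields $X,Y$ on $\widetilde{M}$. Then $(\widetilde{M},\widetilde{g},F^{\ast})$ is also almost product-like, and $(F^{\ast})^{\ast}=F$. Let $(M,g)$ be a hypersurface of $\widetilde{M}$ with induced metric $g$ and unit normal vector field $N$. It is called a tangential hypersurface if $FN$ and $F^{\ast}N$ are tangent to $M$. In that case, for $X\in\Gamma(TM)$ decompose $$FX=\varphi X+\eta^{\ast}(X)N,\qquad F^{\ast}X=\varphi^{\ast}X+\eta(X)N,$$ where $\varphi X,\varphi^{\ast}X$ are tangent to $M$ and $\eta,\eta^{\ast}$ are $1$-forms on $M$. The star on an induced object means that it is formed with $F^{\ast}$ in place of $F$; thus $(\varphi^{\ast})^{\ast}$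 is the tensor formed from $(F^{\ast})^{\ast}$ in the way $\varphi$ is formed from $F$. *)

(* Defs.v *)
From HB Require Import structures.
From mathcomp Require Import all_boot all_order all_algebra.
From mathcomp Require Import all_classical all_reals.
From mathcomp Require Import topology normedtype landau derive.
From mathcomp Require Import ring.
Set Implicit Arguments.
Unset Strict Implicit.
Unset Printing Implicit Defensive.
Import Order.TTheory GRing.Theory Num.Theory.
Import numFieldNormedType.Exports.
Local Open Scope classical_set_scope.
Local Open Scope ring_scope.

Section SmoothOn.
Variable R : realType.

Fixpoint Ck (V W : normedModType R) (k : nat) (U : set V) (f : V -> W) : Prop :=
  if k is k'.+1 then
    (forall x, U x -> differentiable f x) /\ (forall v, Ck k' U ('D_v f))
  else forall x, U x -> {for x, continuous f}.

(* [U] is meant to be open: the derivatives at a point of [U] are those of the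
   total function [f], and depend only on the values of [f] near that point. *)
Definition smooth_on (V W : normedModType R) (U : set V) (f : V -> W) : Prop :=
  forall k, Ck k U f.

Lemma near_eq_differentiable (V W : normedModType R) (f g : V -> W) (x : V) :
  (\near x, f x = g x) -> differentiable f x -> differentiable g x.
Proof.
move=> fg df.
have fgx : f x = g x by exact: (nbhs_singleton fg).
have [dc E] := (diff_locallyP x f).1 df.
have E2 : g \o shift x = cst (g x) + 'd f x +o_ 0 id.
  apply/eqaddoP => e e0.
  have /eqaddoP /(_ e e0) := E.
  have fg0 : \forall h \near (0 : V), f (h + x) = g (h + x).
    by move/nbhs0P: fg; apply: filterS => h; rewrite addrC.
  move=> H; near=> h.
  have hh : f (h + x) = g (h + x) by near: h.
  suff : `|(f \o shift x - (cst (f x) + 'd f x)) h| <= e * `|h|.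
    by rewrite !fctE /shift /= hh fgx.
  by near: h.
have dE : 'd g x = 'd f x :> (V -> W) by apply: diff_unique.
by apply/diff_locallyP; rewrite dE.
Unshelve. all: by end_near. Qed.


Section calculus.
Variables (V W : normedModType R).
Implicit Types (U : set V) (f g : V -> W).

Lemma CkS k U f : Ck k.+1 U f -> Ck k U f.
Proof.
elim: k f => [|k IH] f.
  by case=> df _ x Ux; apply: differentiable_continuous; apply: df.
by case=> df Df; split=> // v; apply: IH; apply: Df.
Qed.

Lemma sub_Ck k U U' f : U' `<=` U -> Ck k U f -> Ck k U' f.
Proof.
move=> sU; elim: k f => [|k IH] f /=; first by move=> Cf x /sU; apply: Cf.
by case=> df Df; split=> [x /sU|v]; [apply: df | apply: IH].
Qed.

Lemma local_Ck k U f :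
  (forall x, U x -> exists U', U' x /\ Ck k U' f) -> Ck k U f.
Proof.
elim: k f => [|k IH] f /= H.
  by move=> x /H[U' [U'x]]; apply.
split=> [x /H[U' [U'x [df _]]]|v]; first exact: df.
by apply: IH => x /H[U' [U'x [_ Df]]]; exists U'.
Qed.

Lemma eq_Ck k U f g : open U -> (forall x, U x -> f x = g x) ->
  Ck k U f -> Ck k U g.
Proof.
move=> oU; elim: k f g => [|k IH] f g fg /=.
  move=> Cf x Ux; have fgx : \near x, f x = g x.
    by apply: filterS fg _; apply: open_nbhs_nbhs.
  suff : g @ x --> g x by [].
  rewrite -fg//; apply: cvg_trans (Cf x Ux).
  exact: near_eq_cvg.
case=> df Df; split=> [x Ux|v].
  apply: near_eq_differentiable (df x Ux).
  by apply: filterS fg _; apply: open_nbhs_nbhs.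
apply: IH (Df v) => x Ux; apply: near_eq_derive.
by apply: filterS fg _; apply: open_nbhs_nbhs.
Qed.

Lemma cst_Ck k U (a : W) : Ck k U (cst a).
Proof.
elim: k a => [|k IH] a /=; first by move=> x _; apply: cst_continuous.
split=> // v; have -> : 'D_v (cst a : V -> W) = cst 0; last exact: IH.
by apply/funext => x; rewrite derive_cst.
Qed.

Lemma CkD k U f g : open U -> Ck k U f -> Ck k U g -> Ck k U (f + g).
Proof.
move=> oU; elim: k f g => [|k IH] f g /=.
  by move=> Cf Cg x Ux; apply: continuousD; [apply: Cf | apply: Cg].
move=> [df Df] [dg Dg]; split=> [x Ux|v].
  by apply: differentiableD; [apply: df | apply: dg].
apply: eq_Ck (IH _ _ (Df v) (Dg v)) => // x Ux.
by rewrite deriveD//; apply: diff_derivable; [apply: df | apply: dg].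
Qed.

Lemma CkZ k U (a : R) f : open U -> Ck k U f -> Ck k U (a *: f).
Proof.
move=> oU; elim: k f => [|k IH] f /=.
  by move=> Cf x Ux; apply: continuousZl_tmp; apply: Cf.
move=> [df Df]; split=> [x Ux|v]; first by apply: differentiableZ; apply: df.
apply: eq_Ck (IH _ (Df v)) => // x Ux.
by rewrite deriveZ//; apply: diff_derivable; apply: df.
Qed.

Lemma Ck_sum k U n (h : 'I_n -> V -> W) : open U ->
  (forall i, Ck k U (h i)) -> Ck k U (\sum_i h i).
Proof.
move=> oU Ch; elim/big_ind: _ => //; first exact: cst_Ck.
by move=> f g; apply: CkD.
Qed.

End calculus.

Lemma CkM k (V : normedModType R) (U : set V) (f g : V -> R) :
  open U -> Ck k U f -> Ck k U g -> Ck k U (f * g).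
Proof.
move=> oU; elim: k f g => [|k IH] f g.
  by move=> Cf Cg x Ux; apply: continuousM; [apply: Cf | apply: Cg].
move=> Cf Cg; have [[df Df] [dg Dg]] := (Cf, Cg); split=> [x Ux|v].
  by apply: differentiableM; [apply: df | apply: dg].
apply: (@eq_Ck _ _ k U (f * 'D_v g + g * 'D_v f)) => //.
  move=> x Ux; rewrite deriveM//; apply: diff_derivable.
    exact: df.
  exact: dg.
apply: CkD => //; apply: IH; [exact: CkS | exact: Dg | exact: CkS | exact: Df].
Qed.

Lemma Ck_coord k (V : normedModType R) m (U : set V) (h : V -> 'rV[R]_m) j :
  open U -> Ck k U h -> Ck k U (fun x => h x 0 j).
Proof.
move=> oU; elim: k h => [|k IH] h /=.
  move=> Ch x Ux; apply: (@continuous_comp _ _ _ h (fun y => y 0 j)).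
    exact: Ch.
  exact: coord_continuous.
move=> [dh Dh]; split=> [x Ux|v].
  exact: (@differentiable_comp _ _ _ _ h (fun y => y 0 j) x (dh x Ux)
    (differentiable_coord _ _ _)).
apply: eq_Ck (IH _ (Dh v)) => // x Ux.
by rewrite derive_mx ?mxE//; apply: diff_derivable; apply: dh.
Qed.

Lemma Ck_comp k n m (A : set 'rV[R]_m) (U : set 'rV[R]_n)
    (g : 'rV[R]_m -> R) (h : 'rV[R]_n -> 'rV[R]_m) :
  open U -> (forall x, U x -> A (h x)) -> Ck k A g -> Ck k U h ->
  Ck k U (g \o h).
Proof.
move=> oU UA; elim: k g => [|k IH] g.
  move=> Cg Ch x Ux; apply: continuous_comp; first exact: Ch.
  by apply: Cg; apply: UA.
move=> [dg Dg] Ch; have [dh Dh] := Ch; split=> [x Ux|v].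
  exact: differentiable_comp (dh _ Ux) (dg _ (UA _ Ux)).
pose S := \sum_(j < m) (fun x => 'D_v h x 0 j) * ('D_(delta_mx 0 j) g \o h).
apply: (@eq_Ck _ _ k U S) => //; last first.
  apply: Ck_sum => // j; apply: CkM => //; first exact: Ck_coord (Dh v).
  by apply: IH; [exact: Dg | exact: CkS].
move=> x Ux; have dhx := dh _ Ux; have dgx := dg _ (UA _ Ux).
rewrite deriveE; last exact: differentiable_comp.
rewrite diff_comp//= -(deriveE v dhx) /S fct_sumE.
rewrite [in RHS](row_sum_delta ('D_v h x)) linear_sum.
by apply: eq_bigr => j _; rewrite linearZ /= -deriveE.
Qed.

End SmoothOn.

Record chart (R : realType) (n : nat) (M : topologicalType) := Chart {
  cdom : set M;
  ccod : set 'rV[R]_n;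
  cmap : M -> 'rV[R]_n;
  cinv : 'rV[R]_n -> M;
  open_cdom : open cdom;
  open_ccod : open ccod;
  cmap_cod : forall p, cdom p -> ccod (cmap p);
  cinv_dom : forall x, ccod x -> cdom (cinv x);
  cmapK : forall p, cdom p -> cinv (cmap p) = p;
  cinvK : forall x, ccod x -> cmap (cinv x) = x;
  cmap_continuous : forall p, cdom p -> {for p, continuous cmap};
  cinv_continuous : forall x, ccod x -> {for x, continuous cinv} }.

(* The atlas need not be maximal. *)
Record manifold (R : realType) (n : nat) := Manifold {
  space :> topologicalType;
  atlas : set (chart R n space);
  manifold_hausdorff : hausdorff_space space;
  manifold_second_countable : @second_countable space;
  atlas_cover : forall p : space, exists2 c, atlas c & cdom c p;
  atlas_compat : forall a b, atlas a -> atlas b ->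
    smooth_on (ccod a `&` cinv a @^-1` cdom b) (cmap b \o cinv a) }.
Arguments atlas {R n} m _.

Section SmoothFunctions.
Variables (R : realType) (n : nat) (M : manifold R n).

Definition smooth_fun : {pred M -> R} := fun f =>
  `[< forall c, atlas M c -> smooth_on (ccod c) (f \o cinv c) >].

Lemma smooth_funP f : reflect
  (forall c, atlas M c -> smooth_on (ccod c) (f \o cinv c)) (f \in smooth_fun).
Proof. exact: asboolP. Qed.

Record Cinf := MkCinf { cinf_fun :> M -> R; _ : cinf_fun \in smooth_fun }.

HB.instance Definition _ := [isSub for cinf_fun].
HB.instance Definition _ := [Choice of Cinf by <:].

Lemma smooth_fun_cst (a : R) : cst a \in smooth_fun.
Proof. by apply/smooth_funP => c _ k; exact: cst_Ck. Qed.

Lemma smooth_fun_subring : subring_closed smooth_fun.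
Proof.
have cM (f g : M -> R) : f \in smooth_fun -> g \in smooth_fun ->
    f * g \in smooth_fun.
  move=> /smooth_funP sf /smooth_funP sg; apply/smooth_funP => c ac k.
  have -> : (f * g) \o cinv c = (f \o cinv c) * (g \o cinv c) by [].
  by apply: CkM; [exact: open_ccod | exact: sf | exact: sg].
split=> // [|f g sf /(cM (cst (-1)) _ (smooth_fun_cst _)) sg].
  exact: smooth_fun_cst.
have -> : f - g = f + cst (-1) * g.
  by apply/funext => x; rewrite /= !fctE mulN1r.
move: sf sg => /smooth_funP sf /smooth_funP sg; apply/smooth_funP => c ac k.
have -> : (f + cst (-1) * g) \o cinv c =
  (f \o cinv c) + ((cst (-1) * g) \o cinv c) by [].
by apply: CkD; [exact: open_ccod | exact: sf | exact: sg].
Qed.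

HB.instance Definition _ := GRing.isSubringClosed.Build (M -> R) smooth_fun
  smooth_fun_subring.

Lemma smooth_fun_scaler : scaler_closed smooth_fun.
Proof.
move=> a f /smooth_funP sf; apply/smooth_funP => c ac k.
have -> : (a *: f) \o cinv c = a *: (f \o cinv c) by [].
by apply: CkZ; [exact: open_ccod | exact: sf].
Qed.

HB.instance Definition _ :=
  GRing.isScaleClosed.Build R (M -> R) smooth_fun smooth_fun_scaler.
HB.instance Definition _ := GRing.SubChoice_isSubComPzRing.Build
  (M -> R) smooth_fun Cinf smooth_fun_subring.
HB.instance Definition _ := [SubZmodule_isSubLmodule of Cinf by <:].

Definition derivation (p : M) : {pred Cinf -> R^o} := fun v =>
  `[< scalar v /\ forall f g : Cinf, v (f * g) = v f * g p + f p * v g >].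

Record tangent (p : M) := MkTangent {
  tangent_fun :> Cinf -> R^o; _ : tangent_fun \in derivation p }.

Section TangentSpace.
Variable p : M.
HB.instance Definition _ := [isSub for @tangent_fun p].
HB.instance Definition _ := [Choice of tangent p by <:].

Lemma derivation_submod : submod_closed (derivation p).
Proof.
split=> [|a u v /asboolP[lu du] /asboolP[lv dv]]; apply/asboolP.
  split=> [b f g|f g].
    by change (0 = b * 0 + 0 :> R); rewrite mulr0 addr0.
  by change (0 = 0 * g p + f p * 0 :> R); rewrite mulr0 mul0r addr0.
split=> [b f g|f g].
  change (a * u (b *: f + g) + v (b *: f + g) =
    b * (a * u f + v f) + (a * u g + v g)).
  by rewrite lu lv /=; ring.
change (a * u (f * g) + v (f * g) =
  (a * u f + v f) * g p + f p * (a * u g + v g)).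
by rewrite du dv; ring.
Qed.

HB.instance Definition _ := GRing.isSubmodClosed.Build R (Cinf -> R^o)
  (derivation p) derivation_submod.
HB.instance Definition _ := [SubChoice_isSubLmodule of tangent p by <:].
End TangentSpace.

End SmoothFunctions.
Arguments Cinf {R n} M.
Arguments smooth_fun {R n} M.

Section SmoothMaps.
Variables (R : realType) (m n : nat) (M : manifold R m) (N : manifold R n).

Record smooth_map := SmoothMap {
  smap :> M -> N;
  smap_continuous : continuous smap;
  smap_smooth : forall a b, atlas M a -> atlas N b ->
    smooth_on (ccod a `&` (smap \o cinv a) @^-1` cdom b)
      (cmap b \o smap \o cinv a) }.

Variable h : smooth_map.

Lemma pullback_subproof (f : Cinf N) : f \o h \in smooth_fun M.
Proof.
apply/smooth_funP => a aM k; apply: local_Ck => x ax.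
have [b bN hb] := atlas_cover (h (cinv a x)).
exists (ccod a `&` (h \o cinv a) @^-1` cdom b); split; first by split.
have oU : open (ccod a `&` (h \o cinv a) @^-1` cdom b).
  rewrite openE => y [ay hy]; apply: filterI.
    by apply: open_nbhs_nbhs; split=> //; exact: open_ccod.
  have : {for y, continuous (h \o cinv a)}.
    by apply: continuous_comp; [exact: cinv_continuous | exact: smap_continuous].
  apply; apply: open_nbhs_nbhs; split=> //; exact: open_cdom.
have := smap_smooth h aM bN k; set U := _ `&` _ in oU *; set H := _ \o cinv a.
move=> sH; apply: (@eq_Ck _ _ _ k U ((f \o cinv b) \o H)) => //.
  by move=> y [ay hy]; rewrite /H /= cmapK.
apply: Ck_comp sH => //; last first.
  by have /smooth_funP/(_ b bN k) := valP f; exact.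
by move=> y [ay hy]; apply: cmap_cod.
Qed.

Definition pullback (f : Cinf N) : Cinf M := MkCinf (pullback_subproof f).

Lemma pushforward_subproof p (v : tangent p) :
  (fun f => v (pullback f)) \in derivation (h p).
Proof.
have /asboolP[lv dv] := valP v; apply/asboolP; split=> [a f g|f g].
  by rewrite -lv; congr (v _); apply: val_inj.
by rewrite -[f (h p)]/(pullback f p) -[g (h p)]/(pullback g p) -dv;
   congr (v _); apply: val_inj.
Qed.

Definition pushforward p (v : tangent p) : tangent (h p) :=
  MkTangent (pushforward_subproof v).

End SmoothMaps.

Section TensorFields.
Variables (R : realType) (n : nat) (M : manifold R n).

Record vector_field := VectorField {
  vfield :> forall p : M, tangent p;
  vfield_smooth : forall f : Cinf M, (fun p => vfield p f) \in smooth_fun M }.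

(* Tensor fields are families of fibrewise (multi)linear maps. Smoothness may be
   tested on global vector fields: by bump functions, every tangent vector and
   every local field near a point extends to a global one. *)
Record tensor11 := Tensor11 {
  tens :> forall p : M, tangent p -> tangent p;
  tens_linear : forall p, linear (@tens p);
  tens_smooth : forall (X : vector_field) (f : Cinf M),
    (fun p => @tens p (X p) f) \in smooth_fun M }.

Record one_form := OneForm {
  form :> forall p : M, tangent p -> R;
  form_linear : forall p, scalar (@form p);
  form_smooth : forall X : vector_field,
    (fun p => @form p (X p)) \in smooth_fun M }.

Record riemannian_metric := RiemannianMetric {
  met :> forall p : M, tangent p -> tangent p -> R;
  met_sym : forall p (u v : tangent p), @met p u v = @met p v u;
  met_linear : forall p (v : tangent p), scalar (fun u => @met p u v);
  met_pos : forall p (v : tangent p), v != 0 -> 0 < @met p v v;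
  met_smooth : forall X Y : vector_field,
    (fun p => @met p (X p) (Y p)) \in smooth_fun M }.

Definition adjoint_of (g : riemannian_metric) (F Fs : tensor11) : Prop :=
  forall (p : M) (u v : tangent p), g p (F p u) v = g p u (Fs p v).

Definition almost_product_like (g : riemannian_metric) (F Fs : tensor11) : Prop :=
  (forall (p : M) (v : tangent p), F p (F p v) = v) /\ adjoint_of g F Fs.

End TensorFields.

Section Hypersurfaces.
Variables (R : realType) (n : nat) (Mt : manifold R n.+1) (M : manifold R n).

(* An immersed hypersurface, the codimension being in the types: [i] is not
   required to be injective; embedded hypersurfaces are a special case. *)
Definition hypersurface (i : smooth_map M Mt) : Prop :=
  forall p : M, injective (pushforward i (p := p)).

Variables (gt : riemannian_metric Mt) (i : smooth_map M Mt).

Definition induced_metric (g : riemannian_metric M) : Prop :=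
  forall (p : M) (u v : tangent p),
    g p u v = gt (i p) (pushforward i u) (pushforward i v).

Record unit_normal := UnitNormal {
  normal :> forall p : M, tangent (i p);
  normal_smooth : forall f : Cinf Mt, (fun p => normal p f) \in smooth_fun M;
  normal_unit : forall p, gt (i p) (normal p) (normal p) = 1;
  normal_orth : forall p (v : tangent p),
    gt (i p) (normal p) (pushforward i v) = 0 }.

Variable N : unit_normal.

Definition tangential (F : tensor11 Mt) : Prop :=
  forall p : M, exists v : tangent p, F (i p) (N p) = pushforward i v.

(* [phi] and [eta] are the objects that [F] induces on the hypersurface: the
   tangential part and the normal coefficient. They are uniquely determined. *)
Definition decomposes (F : tensor11 Mt) (phi : tensor11 M) (eta : one_form M) :
    Prop :=
  forall (p : M) (v : tangent p),
    F (i p) (pushforward i v) = pushforward i (phi p v) + eta p v *: N p.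

End Hypersurfaces.

(* Main.v *)
Require Import Defs.
From HB Require Import structures.
From mathcomp Require Import all_boot all_order all_algebra.
From mathcomp Require Import all_classical all_reals.
From mathcomp Require Import topology normedtype.
Local Open Scope ring_scope.

Import GRing.Theory.

(** The induced metric is the ambient one on pushforwards, so both identities come from expanding
    the adjunction of [F] and [Fs] along tangential plus normal parts: for the pair X, Y the normal
    terms vanish by orthogonality; for the pair FX, Y, F^2 = I gives g(X,Y) on one side and
    [met_normal_decomposition] expands the other. For the last claim, nondegeneracy makes the
    adjoint of [Fs] unique, hence equal to [F] ([adjoint_adjoint]), and the tangential part of a
    vector is unique ([normal_decomposition_inj]). *)

Lemma metDZl (R : realType) (n : nat) (M : manifold R n)
    (g : riemannian_metric M) (p : M) (a : R) (u v w : tangent p) :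
  g p (u + a *: v) w = g p u w + a * g p v w.
Proof. by rewrite addrC (met_linear g w a v u) addrC. Qed.

Lemma metDZr (R : realType) (n : nat) (M : manifold R n)
    (g : riemannian_metric M) (p : M) (a : R) (u v w : tangent p) :
  g p w (u + a *: v) = g p w u + a * g p w v.
Proof. by rewrite met_sym metDZl !(met_sym g _ w). Qed.

(** Otherwise u - v would be a nonzero vector of square norm 0, against positivity. *)
Lemma met_nondegenerate (R : realType) (n : nat) (M : manifold R n)
    (g : riemannian_metric M) (p : M) (u v : tangent p) :
  (forall w, g p w u = g p w v) -> u = v.
Proof.
move=> uv; apply/eqP; rewrite -subr_eq0; apply/negP => /negP uv_neq0.
have := met_pos g uv_neq0.
(* Only the second argument u - v is expanded, as u + (-1) v; the first serves as the test vector
   w. *)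
by rewrite -{2}[v]scale1r -scaleNr metDZr uv mulN1r subrr Order.POrderTheory.ltxx.
Qed.

(** By symmetry of the metric, [F] is itself an adjoint of [Fs], and nondegeneracy allows only
    one. *)
Lemma adjoint_adjoint (R : realType) (n : nat) (M : manifold R n)
    (g : riemannian_metric M) (F Fs Fss : tensor11 M) :
  adjoint_of g F Fs -> adjoint_of g Fs Fss ->
  forall (p : M) (v : tangent p), Fss p v = F p v.
Proof.
move=> FFs FsFss p v; apply: (@met_nondegenerate _ _ _ g) => w.
by rewrite -FsFss met_sym -FFs met_sym.
Qed.

(** Turns pointwise agreement into equality of records: the linearity and smoothness fields are
    propositions, hence proof-irrelevant. *)
Lemma tensor11_ext (R : realType) (n : nat) (M : manifold R n)
    (S T : tensor11 M) :
  (forall (p : M) (v : tangent p), S p v = T p v) -> S = T.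
Proof.
case: S T => [S Sl Ss] [T Tl Ts] /= ST.
have eqST : S = T by apply: functional_extensionality_dep => p; apply/funext/ST.
by case: _ / eqST in Tl Ts ST *; congr Tensor11; exact: Prop_irrelevance.
Qed.

Section Hypersurface.
Variables (R : realType) (n : nat) (Mt : manifold R n.+1) (M : manifold R n).
Variables (gt : riemannian_metric Mt) (i : smooth_map M Mt).
Variable N : unit_normal gt i.

Lemma met_normal_decomposition (p : M) (a b : R) (u v : tangent p) :
  gt (i p) (pushforward i u + a *: N p) (pushforward i v + b *: N p) =
  gt (i p) (pushforward i u) (pushforward i v) + a * b.
Proof.
rewrite metDZl !metDZr normal_unit !normal_orth.
by rewrite (met_sym gt _ (N p)) normal_orth mulr0 addr0 mulr1 add0r.
Qed.

(** Pairing with the unit normal isolates the coefficients, so a = b; cancelling the normal parts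
    leaves equal pushforwards, and [i] is an immersion. *)
Lemma normal_decomposition_inj (p : M) (a b : R) (u v : tangent p) :
  hypersurface i ->
  pushforward i u + a *: N p = pushforward i v + b *: N p -> u = v.
Proof.
move=> hi uv.
have ab : a = b.
  have := congr1 (fun w => gt (i p) (N p) w) uv.
  by rewrite !metDZr normal_unit !normal_orth !mulr1 !add0r.
by apply: hi; move: uv; rewrite ab => /addIr.
Qed.

End Hypersurface.

Theorem lemma4p4 (R : realType) (n : nat)
  (Mt : manifold R n.+1) (gt : riemannian_metric Mt) (F Fs : tensor11 Mt)
  (hF : almost_product_like gt F Fs)
  (M : manifold R n) (i : smooth_map M Mt) (hi : hypersurface i)
  (g : riemannian_metric M) (hg : induced_metric gt i g)
  (N : unit_normal gt i)
  (tF : tangential N F) (tFs : tangential N Fs)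
  (phi phis : tensor11 M) (eta etas : one_form M)
  (dF : decomposes N F phi etas) (dFs : decomposes N Fs phis eta) :
  (forall (X Y : vector_field M) (p : M),
     g p (phi p (X p)) (Y p) = g p (X p) (phis p (Y p))) /\
  (forall (X Y : vector_field M) (p : M),
     g p (phi p (X p)) (phis p (Y p)) =
       g p (X p) (Y p) - etas p (X p) * eta p (Y p)) /\
  (forall (Fss : tensor11 Mt) (phiss : tensor11 M) (etass : one_form M),
     adjoint_of gt Fs Fss -> decomposes N Fss phiss etass -> phiss = phi).
Proof.
have [FF FFs] := hF.
split; [|split].
- move=> X Y p; rewrite !hg.
  have := FFs _ (pushforward i (X p)) (pushforward i (Y p)).
  rewrite dF dFs metDZl metDZr normal_orth.
  by rewrite (met_sym gt _ (N p)) normal_orth !mulr0 !addr0.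
- move=> X Y p; rewrite !hg.
  (* The adjunction is taken at FX rather than X, so that F^2 = I applies on its left side. *)
  have := FFs _ (F _ (pushforward i (X p))) (pushforward i (Y p)).
  by rewrite FF dF dFs met_normal_decomposition => ->; rewrite addrK.
- move=> Fss phiss etass FsFss dFss; apply: tensor11_ext => p v.
  apply: (@normal_decomposition_inj _ _ _ _ _ _ N _ (etass p v) (etas p v)) => //.
  by rewrite -dFss -dF (adjoint_adjoint _ _ _ _ _ _ _ FFs FsFss).
Qed.
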